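(* Let $A_k=\begin{bmatrix}a_k&b_k\\c_k&d_k\end{bmatrix}\in\mathbb{R}^{2\times2}$ with $\det(A_k)=1$ and $b_k\neq0$, for $k=1,2$. Let $\phi\in L^2(\mathbb{R}^2,\mathbb{H})\setminus\{0\}$ be a window function and let $f\in L^2(\mathbb{R}^2,\mathbb{H})$. For $\mathbf{r}=(r_1,r_2)\in\mathbb{R}^2$ put $T_{\mathbf{r}}f(\mathbf{x})=f(\mathbf{x}-\mathbf{r})$. Then for all $\mathbf{w}=(\omega_1,\omega_2)$ and $\mathbf{u}=(u_1,u_2)$ in $\mathbb{R}^2$, $$G^{A_1,A_2}_{\phi}\{T_{\mathbf{r}}f\}(\mathbf{w},\mathbf{u})=e^{\mathbf{i}r_1\omega_1c_1}e^{-\mathbf{i}\frac{a_1r_1^2}{2}c_1}\,G^{A_1,A_2}_{\phi}\{f\}(\mathbf{m},\mathbf{n})\,e^{\mathbf{j}r_2\omega_2c_2}e^{-\mathbf{j}\frac{a_2r_2^2}{2}c_2},$$ where $\mathbf{m}=(m_1,m_2)$, $\mathbf{n}=(n_1,n_2)\in\mathbb{R}^2$ with $m_k=\omega_k-a_kr_k$ and $n_k=u_k-r_k$ for $k=1,2$.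
   Context: $\mathbb{H}$ denotes the quaternions $q=[q]_0+\mathbf{i}[q]_1+\mathbf{j}[q]_2+\mathbf{k}[q]_3$, $[q]_l\in\mathbb{R}$, with $\mathbf{i}^2=\mathbf{j}^2=\mathbf{k}^2=-1$, $\mathbf{i}\mathbf{j}=-\mathbf{j}\mathbf{i}=\mathbf{k}$, $\mathbf{j}\mathbf{k}=-\mathbf{k}\mathbf{j}=\mathbf{i}$, $\mathbf{k}\mathbf{i}=-\mathbf{i}\mathbf{k}=\mathbf{j}$; conjugate $\overline{q}=[q]_0-\mathbf{i}[q]_1-\mathbf{j}[q]_2-\mathbf{k}[q]_3$ and norm $|q|=\sqrt{q\overline{q}}$. $L^2(\mathbb{R}^2,\mathbb{H})$ is the space of functions $f:\mathbb{R}^2\to\mathbb{H}$ with $\|f\|^2=\|f\|^2_{L^2(\mathbb{R}^2)}=\int_{\mathbb{R}^2}|f(\mathbf{x})|^2\,d\mathbf{x}<\infty$. For $\mathbf{x}=(x_1,x_2)$, $\mathbf{w}=(\omega_1,\omega_2)$, $\mathbf{u}=(u_1,u_2)$ in $\mathbb{R}^2$, the kernels are $$K_{A_1}^{\mathbf{i}}(x_1,\omega_1)=\frac{1}{\sqrt{2\pi b_1}}e^{\mathbf{i}\left(\frac{a_1}{2b_1}x_1^2-\frac{x_1\omega_1}{b_1}+\frac{d_1}{2b_1}\omega_1^2-\frac{\pi}{4}\right)},\qquad K_{A_2}^{\mathbf{j}}(x_2,\omega_2)=\frac{1}{\sqrt{2\pi b_2}}e^{\mathbf{j}\left(\frac{a_2}{2b_2}x_2^2-\frac{x_2\omega_2}{b_2}+\frac{d_2}{2b_2}\omega_2^2-\frac{\pi}{4}\right)},$$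 where for negative $b_1$ (resp. $b_2$) the square root is taken in $\mathbb{R}+\mathbf{i}\mathbb{R}$ as $\mathbf{i}\sqrt{2\pi|b_1|}$ (resp. in $\mathbb{R}+\mathbf{j}\mathbb{R}$ as $\mathbf{j}\sqrt{2\pi|b_2|}$). The two-sided quaternion windowed linear canonical transform (QWLCT) of $f$ with respect to the window $\phi$ is $$G^{A_1,A_2}_{\phi}f(\mathbf{w},\mathbf{u})=G^{A_1,A_2}_{\phi}\{f\}(\mathbf{w},\mathbf{u})=\int_{\mathbb{R}^2}K_{A_1}^{\mathbf{i}}(x_1,\omega_1)\,f(\mathbf{x})\,\overline{\phi(\mathbf{x}-\mathbf{u})}\,K_{A_2}^{\mathbf{j}}(x_2,\omega_2)\,d\mathbf{x}.$$ *)

(* Defs.v *)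
From HB Require Import structures.
From mathcomp Require Import all_boot all_order all_algebra.
From mathcomp Require Import all_classical all_reals all_analysis.
From mathcomp Require Import ring lra.
Set Implicit Arguments.
Unset Strict Implicit.
Unset Printing Implicit Defensive.
Import Order.TTheory GRing.Theory Num.Theory.
Local Open Scope ring_scope.

(** * Quaternions *)

Record quat (R : Type) : Type := Quat { q0 : R; q1 : R; q2 : R; q3 : R }.

Definition tuple_of_quat (R : Type) (q : quat R) : R * R * R * R :=
  (q0 q, q1 q, q2 q, q3 q).
Definition quat_of_tuple (R : Type) (t : R * R * R * R) : quat R :=
  let: (a, b, c, d) := t in Quat a b c d.
Lemma tuple_of_quatK (R : Type) :
  cancel (@tuple_of_quat R) (@quat_of_tuple R).
Proof. by case. Qed.

HB.instance Definition _ (R : eqType) := Equality.copy (quat R)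
  (can_type (@tuple_of_quatK R)).
HB.instance Definition _ (R : choiceType) := Choice.copy (quat R)
  (can_type (@tuple_of_quatK R)).

Section QuatRing.
Variable R : realFieldType.
Implicit Types p q : quat R.

Definition quat_zero : quat R := Quat 0 0 0 0.
Definition quat_one : quat R := Quat 1 0 0 0.
Definition quat_opp q := Quat (- q0 q) (- q1 q) (- q2 q) (- q3 q).
Definition quat_add p q :=
  Quat (q0 p + q0 q) (q1 p + q1 q) (q2 p + q2 q) (q3 p + q3 q).

(* Hamilton product: i^2 = j^2 = k^2 = -1, ij = -ji = k, jk = -kj = i,
   ki = -ik = j. *)
Definition quat_mul p q := Quat
  (q0 p * q0 q - q1 p * q1 q - q2 p * q2 q - q3 p * q3 q)
  (q0 p * q1 q + q1 p * q0 q + q2 p * q3 q - q3 p * q2 q)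
  (q0 p * q2 q - q1 p * q3 q + q2 p * q0 q + q3 p * q1 q)
  (q0 p * q3 q + q1 p * q2 q - q2 p * q1 q + q3 p * q0 q).

Definition quat_scale (a : R) q := Quat (a * q0 q) (a * q1 q) (a * q2 q) (a * q3 q).

Fact quat_addA : associative quat_add.
Proof. by move=> [????] [????] [????]; congr Quat => /=; ring. Qed.
Fact quat_addC : commutative quat_add.
Proof. by move=> [????] [????]; congr Quat => /=; ring. Qed.
Fact quat_add0 : left_id quat_zero quat_add.
Proof. by move=> [????]; congr Quat => /=; ring. Qed.
Fact quat_addN : left_inverse quat_zero quat_opp quat_add.
Proof. by move=> [????]; congr Quat => /=; ring. Qed.
HB.instance Definition _ := GRing.isZmodule.Build (quat R)
  quat_addA quat_addC quat_add0 quat_addN.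

Fact quat_mulA : associative quat_mul.
Proof. by move=> [????] [????] [????]; congr Quat => /=; ring. Qed.
Fact quat_mul1l : left_id quat_one quat_mul.
Proof. by move=> [????]; congr Quat => /=; ring. Qed.
Fact quat_mul1r : right_id quat_one quat_mul.
Proof. by move=> [????]; congr Quat => /=; ring. Qed.
Fact quat_mulDl : left_distributive quat_mul quat_add.
Proof. by move=> [????] [????] [????]; congr Quat => /=; ring. Qed.
Fact quat_mulDr : right_distributive quat_mul quat_add.
Proof. by move=> [????] [????] [????]; congr Quat => /=; ring. Qed.
Fact quat_one_neq0 : quat_one != quat_zero.
Proof. by apply/eqP => -[] /eqP; rewrite oner_eq0. Qed.
HB.instance Definition _ := GRing.Zmodule_isNzRing.Build (quat R)
  quat_mulA quat_mul1l quat_mul1r quat_mulDl quat_mulDr quat_one_neq0.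

Fact quat_scaleA a b q : quat_scale a (quat_scale b q) = quat_scale (a * b) q.
Proof. by case: q => ????; congr Quat => /=; ring. Qed.
Fact quat_scale1 : left_id 1 quat_scale.
Proof. by move=> [????]; congr Quat => /=; ring. Qed.
Fact quat_scaleDr : right_distributive quat_scale +%R.
Proof. by move=> a [????] [????]; congr Quat => /=; ring. Qed.
Fact quat_scaleDl q : {morph quat_scale^~ q : a b / a + b}.
Proof. by case: q => ???? a b; congr Quat => /=; ring. Qed.
HB.instance Definition _ := GRing.Zmodule_isLmodule.Build R (quat R)
  quat_scaleA quat_scale1 quat_scaleDr quat_scaleDl.

Fact quat_scaleAl a p q : a *: (p * q) = (a *: p) * q.
Proof. by case: p q => [????] [????]; congr Quat => /=; ring. Qed.
HB.instance Definition _ := GRing.Lmodule_isLalgebra.Build R (quat R)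
  quat_scaleAl.
Fact quat_scaleAr a p q : a *: (p * q) = p * (a *: q).
Proof. by case: p q => [????] [????]; congr Quat => /=; ring. Qed.
HB.instance Definition _ := GRing.Lalgebra_isAlgebra.Build R (quat R)
  quat_scaleAr.

Definition qi : quat R := Quat 0 1 0 0.
Definition qj : quat R := Quat 0 0 1 0.
Definition qk : quat R := Quat 0 0 0 1.

Definition qconj q : quat R := Quat (q0 q) (- q1 q) (- q2 q) (- q3 q).

(* [q * qconj q] is real, so its real part is the squared norm. *)
Definition qnorm2 q : R := q0 (q * qconj q).

Fact qnorm2E q : qnorm2 q = q0 q ^+ 2 + q1 q ^+ 2 + q2 q ^+ 2 + q3 q ^+ 2.
Proof. by case: q => a b c d; rewrite /qnorm2 /=; ring. Qed.

Fact qnorm2_eq0 q : (qnorm2 q == 0) = (q == 0).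
Proof.
case: q => a b c d; rewrite qnorm2E /=; apply/eqP/eqP; last first.
  by case=> -> -> -> ->; ring.
move=> /eqP; rewrite !paddr_eq0 ?addr_ge0 ?sqr_ge0 // !sqrf_eq0.
by move=> /andP[/andP[/andP[/eqP-> /eqP->] /eqP->] /eqP->].
Qed.

Definition quat_inv q : quat R := (qnorm2 q)^-1 *: qconj q.

Fact quat_mulVq : {in [pred q : quat R | q != 0], left_inverse 1 quat_inv *%R}.
Proof.
move=> q; rewrite inE -qnorm2_eq0 => q_neq0; rewrite /quat_inv -scalerAl.
rewrite (_ : qconj q * q = qnorm2 q *: 1) ?scalerA ?mulVf ?scale1r //.
by rewrite qnorm2E; case: (q) => a b c d; congr Quat => /=; ring.
Qed.
Fact quat_mulqV : {in [pred q : quat R | q != 0], right_inverse 1 quat_inv *%R}.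
Proof.
move=> q; rewrite inE -qnorm2_eq0 => q_neq0; rewrite /quat_inv -scalerAr.
rewrite (_ : q * qconj q = qnorm2 q *: 1) ?scalerA ?mulVf ?scale1r //.
by rewrite qnorm2E; case: (q) => a b c d; congr Quat => /=; ring.
Qed.
Fact quat_unitP p q : q * p = 1 /\ p * q = 1 -> p != 0.
Proof.
by case=> _ /eqP pq1; apply: contraTN pq1 => /eqP ->;
  rewrite mul0r eq_sym oner_eq0.
Qed.
Fact quat_inv_out : {in [predC [pred q : quat R | q != 0]], quat_inv =1 id}.
Proof.
by move=> q; rewrite !inE negbK => /eqP ->; congr Quat => /=; ring.
Qed.
HB.instance Definition _ := GRing.NzRing_hasMulInverse.Build (quat R)
  quat_mulVq quat_mulqV quat_unitP quat_inv_out.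

End QuatRing.

Arguments qi {R}.
Arguments qj {R}.
Arguments qk {R}.

Definition qnorm (R : rcfType) (q : quat R) : R := Num.sqrt (qnorm2 q).

(** * Quaternion-valued functions on the plane *)

Definition mu2 (R : realType) :
    set (measurableTypeR R * measurableTypeR R) -> \bar R :=
  (@lebesgue_measure R \x @lebesgue_measure R)%E.
HB.instance Definition _ (R : realType) := Measure.on (@mu2 R).

Section PlaneFunctions.
Variable R : realType.
Implicit Types f phi : R * R -> quat R.

Definition qmeasurable f : Prop :=
  [/\ measurable_fun [set: measurableTypeR R * measurableTypeR R] (fun x => q0 (f x)),
      measurable_fun [set: measurableTypeR R * measurableTypeR R] (fun x => q1 (f x)),
      measurable_fun [set: measurableTypeR R * measurableTypeR R] (fun x => q2 (f x)) &
      measurable_fun [set: measurableTypeR R * measurableTypeR R] (fun x => q3 (f x))].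

(* Elements of L^2(R^2, H) are given by Borel measurable representatives (every
   class of Lebesgue measurable functions has one). *)
Definition L2 f : Prop :=
  qmeasurable f /\ (\int[@mu2 R]_x ((qnorm (f x)) ^+ 2)%:E < +oo)%E.

(* [f] represents the zero element of L^2(R^2, H). *)
Definition L2_zero f : Prop := {ae @mu2 R, forall x, f x = 0}.

(* Componentwise Lebesgue integral over R^2; it is only meaningful when the
   four components are integrable, as [Rintegral] is total. *)
Definition qint f : quat R := Quat
  (\int[@mu2 R]_x q0 (f x)) (\int[@mu2 R]_x q1 (f x))
  (\int[@mu2 R]_x q2 (f x)) (\int[@mu2 R]_x q3 (f x)).

Definition translate (r : R * R) f : R * R -> quat R := fun x => f (x - r).

(** * The two-sided quaternion windowed linear canonical transform *)

(* e^{mu t} for a pure unit quaternion mu (here i or j), by Euler's formula. *)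
Definition qexp (mu : quat R) (t : R) : quat R := (cos t)%:A + sin t *: mu.

(* Square root of the real number t in the plane R + mu R; for t < 0 the branch
   is mu * sqrt |t|. *)
Definition qsqrt (mu : quat R) (t : R) : quat R :=
  if 0 <= t then (Num.sqrt t)%:A else Num.sqrt `|t| *: mu.

Definition lct_kernel (mu : quat R) (A : 'M[R]_2) (x w : R) : quat R :=
  let a := A 0 0 in let b := A 0 1 in let d := A 1 1 in
  (qsqrt mu (2 * pi * b))^-1 *
  qexp mu (a / (2 * b) * x ^+ 2 - x * w / b + d / (2 * b) * w ^+ 2 - pi / 4).

(* For phi and f in L^2 the integrand is integrable: its norm is a constant
   multiple of |f x| |phi (x - u)|. *)
Definition qwlct (A1 A2 : 'M[R]_2) phi f (w u : R * R) : quat R :=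
  qint (fun x => lct_kernel qi A1 x.1 w.1 * f x * qconj (phi (x - u)) *
                 lct_kernel qj A2 x.2 w.2).

End PlaneFunctions.

(* Main.v *)
Require Import Defs.
From mathcomp Require Import all_boot all_order all_algebra.
From mathcomp Require Import all_classical all_reals all_analysis.
From mathcomp Require Import measurable_realfun.
From mathcomp Require Import ring lra.

(** The identity is the change of variables x = y + r in the defining integral.
    Lebesgue measure on the plane is translation invariant, so the integral of
    the transform of T_r f at (w, u) equals the integral over y of

      K1(y1 + r1, w1) f(y) conj(phi(y - (u - r))) K2(y2 + r2, w2).

    The window is now centred at n = u - r.  Completing the square in the phase
    of each kernel gives, with a d - b c = 1,

      K(y + r, w) = e^(mu r w c) e^(- mu a r^2 c / 2) K(y, w - a r)

    ([lct_kernel_shift]), where mu = i for the left kernel and mu = j for the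
    right one.  Quaternions do not commute, but both exponentials and the kernel
    with the same mu lie in the commutative plane R + mu R; so the factor from
    K1 can be moved to the far left and the factor from K2 to the far right,
    away from f and phi.

    It remains to take the constants p and q out of the integral of p F q.
    A component of p F q is a real linear combination of all four components of
    F, hence this step ([qint_mul]) needs each component of F to be integrable.
    That follows from |F| = C |f| |phi(. - n)|, where |f| |phi(. - n)| is
    dominated by |f|^2 + |phi(. - n)|^2
    ([qintegrable_qwlct_integrand]). *)

Set Implicit Arguments.
Unset Strict Implicit.
Unset Printing Implicit Defensive.
Import Order.TTheory GRing.Theory Num.Theory.
Local Open Scope classical_set_scope.
Local Open Scope ring_scope.

(** * Translation invariance of the plane measure *)

Lemma measurable_shift (R : realType) (s : R) :
  measurable_fun [set: measurableTypeR R] (fun x : R => x - s).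
Proof. by apply: measurable_funB. Qed.

(** A measure on the line that agrees with Lebesgue measure on the half-open
    intervals is Lebesgue measure, and a translation preserves their lengths. *)
Lemma lebesgue_measure_shift (R : realType) (s : R)
    (A : set (measurableTypeR R)) : measurable A ->
  lebesgue_measure ((fun x : R => x - s) @^-1` A) = lebesgue_measure A.
Proof.
move=> mA; apply/esym.
have mshift := @measurable_shift R s.
apply: (@lebesgue_measure_unique R (pushforward lebesgue_measure
  ((fun x : R => x - s) : measurableTypeR R -> measurableTypeR R))) => //.
move=> _ [[a b] _ <-] /=; rewrite /pushforward.
have -> : (fun x : R => x - s) @^-1` `]a, b]%classic
    = `]a + s, b + s]%classic.
  by apply/seteqP; split => x /=; rewrite !in_itv /= ltrBrDr lerBlDr.
rewrite !lebesgue_measure_itv /= !lte_fin ltrD2r.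
by case: ifP => // _; rewrite -!EFinB; congr EFin; ring.
Qed.

(** The map x |-> x - r, given coordinatewise because the measurable structure
    of the plane is that of a product of two Borel lines. *)
Definition plane_shift (R : realType) (r : R * R) :
    measurableTypeR R * measurableTypeR R ->
    measurableTypeR R * measurableTypeR R :=
  fun x => (x.1 - r.1, x.2 - r.2).

Lemma measurable_plane_shift (R : realType) (r : R * R) :
  measurable_fun [set: measurableTypeR R * measurableTypeR R] (@plane_shift R r).
Proof.
by apply: measurable_fun_pair; apply: measurable_funB.
Qed.

(** The image of the plane measure under a translation gives every rectangle the
    product of the lengths of its sides, which characterizes the product
    measure. *)
Lemma mu2_shift (R : realType) (r : R * R)
    (X : set (measurableTypeR R * measurableTypeR R)) : measurable X ->
  @mu2 R (@plane_shift R r @^-1` X) = @mu2 R X.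
Proof.
move=> mX; apply/esym.
have mshift := @measurable_plane_shift R r.
apply: (@product_measure_unique _ _ _ _ R lebesgue_measure lebesgue_measure
  (pushforward (@mu2 R) (@plane_shift R r))) => //.
move=> A B mA mB /=; rewrite /pushforward.
have -> : @plane_shift R r @^-1` (A `*` B) =
  ((fun x : R => x - r.1) @^-1` A) `*` ((fun x : R => x - r.2) @^-1` B) by [].
have mpre (s : R) (C : set (measurableTypeR R)) : measurable C ->
    measurable ((fun x : R => x - s) @^-1` C : set (measurableTypeR R)).
  move=> mC; rewrite -[X in measurable X]setTI; exact: (@measurable_shift R s).
rewrite /mu2 product_measure1E; [|exact: mpre..].
by rewrite /= !lebesgue_measure_shift.
Qed.

(** The image of [mu] under [phi] is [mu] itself, so this is the change of
    variables along [phi], applied to the positive and negative parts of [g]. *)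
Lemma integral_measure_preserving d (T : measurableType d) (R : realType)
    (mu : {measure set T -> \bar R}) (phi : T -> T) (g : T -> \bar R) :
  measurable_fun setT phi ->
  (forall A, measurable A -> mu (phi @^-1` A) = mu A) ->
  measurable_fun setT g ->
  (\int[mu]_x g (phi x) = \int[mu]_x g x)%E.
Proof.
move=> mphi phi_inv.
have ge0_case h : measurable_fun setT h -> (forall x, 0 <= h x)%E ->
    (\int[mu]_x h (phi x) = \int[mu]_x h x)%E.
  move=> mh h0; transitivity (\int[pushforward mu phi]_x h x)%E.
    by rewrite ge0_integral_pushforward.
  by apply: eq_measure_integral => A mA _; exact: phi_inv.
move=> mg; rewrite integralE [RHS]integralE; congr (_ - _)%E.
- under eq_integral do rewrite (funepos_comp g phi) /=.
  by apply: ge0_case => //; exact: measurable_funepos.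
- under eq_integral do rewrite (funeneg_comp g phi) /=.
  by apply: ge0_case => //; exact: measurable_funeneg.
Qed.

Lemma integral_plane_shift (R : realType) (r : R * R)
    (g : measurableTypeR R * measurableTypeR R -> \bar R) :
  measurable_fun setT g ->
  (\int[@mu2 R]_x g (@plane_shift R r x) = \int[@mu2 R]_x g x)%E.
Proof.
apply: integral_measure_preserving; first exact: measurable_plane_shift.
exact: mu2_shift.
Qed.

(** * Integrals of quaternion-valued functions *)

Definition qintegrable (R : realType) (F : R * R -> quat R) : Prop :=
  [/\ (@mu2 R).-integrable setT (EFin \o (fun x => q0 (F x))),
      (@mu2 R).-integrable setT (EFin \o (fun x => q1 (F x))),
      (@mu2 R).-integrable setT (EFin \o (fun x => q2 (F x))) &
      (@mu2 R).-integrable setT (EFin \o (fun x => q3 (F x)))].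

Lemma qmeasurable_plane_shift (R : realType) (r : R * R) (F : R * R -> quat R) :
  qmeasurable F -> qmeasurable (fun x => F (@plane_shift R r x)).
Proof.
case=> F0 F1 F2 F3; have mr := @measurable_plane_shift R r.
by split; [apply: (measurableT_comp F0 mr) | apply: (measurableT_comp F1 mr)
  | apply: (measurableT_comp F2 mr) | apply: (measurableT_comp F3 mr)].
Qed.

Lemma qint_plane_shift (R : realType) (r : R * R) (F : R * R -> quat R) :
  qmeasurable F -> qint (fun x => F (@plane_shift R r x)) = qint F.
Proof.
have shift (h : R * R -> R) :
    measurable_fun [set: measurableTypeR R * measurableTypeR R] h ->
    \int[@mu2 R]_x h (@plane_shift R r x) = \int[@mu2 R]_x h x.
  move=> mh; congr fine.
  by apply: (integral_plane_shift r (g := EFin \o h)); exact/measurable_EFinP.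
by case=> F0 F1 F2 F3; congr Quat; [exact: (shift _ F0) | exact: (shift _ F1)
  | exact: (shift _ F2) | exact: (shift _ F3)].
Qed.

Lemma qmeasurableM (R : realType) (f g : R * R -> quat R) :
  qmeasurable f -> qmeasurable g -> qmeasurable (fun x => f x * g x).
Proof.
case=> f0 f1 f2 f3 [g0 g1 g2 g3]; split => /=;
  by do ?[apply: measurable_funB | apply: measurable_funD |
          apply: measurable_funM].
Qed.

Lemma Rintegral_lincomb4 d (T : measurableType d) (R : realType)
    (mu : {measure set T -> \bar R}) (g0 g1 g2 g3 : T -> R) (a b c e : R) :
  mu.-integrable setT (EFin \o g0) -> mu.-integrable setT (EFin \o g1) ->
  mu.-integrable setT (EFin \o g2) -> mu.-integrable setT (EFin \o g3) ->
  \int[mu]_x (g0 x * a + g1 x * b + g2 x * c + g3 x * e) =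
  \int[mu]_x g0 x * a + \int[mu]_x g1 x * b + \int[mu]_x g2 x * c +
  \int[mu]_x g3 x * e.
Proof.
move=> i0 i1 i2 i3.
have Z g k : mu.-integrable setT (EFin \o g) ->
    mu.-integrable setT (EFin \o (fun x => g x * k)).
  move=> ig; rewrite (_ : _ \o _ = fun x => (k%:E * (EFin \o g) x)%E).
    exact: integrableZl.
  by apply/funext => x /=; rewrite EFinM muleC.
have D g h : mu.-integrable setT (EFin \o g) ->
    mu.-integrable setT (EFin \o h) ->
    mu.-integrable setT (EFin \o (fun x => g x + h x)).
  exact: integrableD.
have i01 := D _ _ (Z _ a i0) (Z _ b i1).
have i012 := D _ _ i01 (Z _ c i2).
rewrite (RintegralD measurableT i012 (Z _ e i3)).
rewrite (RintegralD measurableT i01 (Z _ c i2)).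
rewrite (RintegralD measurableT (Z _ a i0) (Z _ b i1)).
by rewrite !RintegralZr.
Qed.

(** The map z |-> p z q is real linear, so it is determined by its values on 1, i,
    j, k; each component of [p * F x * q] is then a linear combination of those
    of [F x] with constant coefficients. *)
Lemma qint_mul (R : realType) (p q : quat R) (F : R * R -> quat R) :
  qintegrable F -> qint (fun x => p * F x * q) = p * qint F * q.
Proof.
case=> F0 F1 F2 F3.
have decomp z : p * z * q = q0 z *: (p * q) + q1 z *: (p * qi * q)
    + q2 z *: (p * qj * q) + q3 z *: (p * qk * q).
  by case: z p q => [????] [????] [????]; congr Quat => /=; ring.
have -> : (fun x => p * F x * q) = (fun x => q0 (F x) *: (p * q)
    + q1 (F x) *: (p * qi * q) + q2 (F x) *: (p * qj * q)
    + q3 (F x) *: (p * qk * q)).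
  by apply/funext => x; exact: decomp.
rewrite [RHS]decomp; congr Quat; exact: (Rintegral_lincomb4 _ _ _ _ F0 F1 F2 F3).
Qed.

(** Euler's four-square identity. *)
Lemma qnorm2M (R : realFieldType) (p q : quat R) :
  qnorm2 (p * q) = qnorm2 p * qnorm2 q.
Proof. by rewrite !qnorm2E; case: p q => [????] [????] /=; ring. Qed.

Lemma qnorm2_conj (R : realFieldType) (q : quat R) :
  qnorm2 (qconj q) = qnorm2 q.
Proof. by rewrite !qnorm2E /= !sqrrN. Qed.

Lemma qnorm2_ge0 (R : realFieldType) (q : quat R) : 0 <= qnorm2 q.
Proof. by rewrite qnorm2E !addr_ge0 ?sqr_ge0. Qed.

Lemma qmeasurable_qnorm2 (R : realType) (F : R * R -> quat R) :
  qmeasurable F ->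
  measurable_fun [set: measurableTypeR R * measurableTypeR R]
    (fun x => qnorm2 (F x)).
Proof.
case=> F0 F1 F2 F3; under eq_fun do rewrite qnorm2E.
by do 3?apply: measurable_funD; apply: measurable_funX.
Qed.

Lemma qmeasurable_conj (R : realType) (F : R * R -> quat R) :
  qmeasurable F -> qmeasurable (fun x => qconj (F x)).
Proof. by case=> F0 F1 F2 F3; split => //=; apply: measurable_funN. Qed.

Lemma qmeasurable_cst (R : realType) (p : quat R) : qmeasurable (fun=> p).
Proof. by split; apply: measurable_cst. Qed.

Lemma L2_qnorm2_integrable (R : realType) (f : R * R -> quat R) :
  L2 f -> (@mu2 R).-integrable setT (EFin \o (fun x => qnorm2 (f x))).
Proof.
case=> mf f_fin; apply/integrableP; split.
  by apply/measurable_EFinP; exact: qmeasurable_qnorm2.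
apply: le_lt_trans f_fin; rewrite le_eqVlt; apply/orP; left; apply/eqP.
apply: eq_integral => x _ /=.
by rewrite ger0_norm ?qnorm2_ge0// /qnorm sqr_sqrtr ?qnorm2_ge0.
Qed.

Lemma L2_plane_shift (R : realType) (r : R * R) (f : R * R -> quat R) :
  L2 f -> L2 (fun x => f (@plane_shift R r x)).
Proof.
move=> L2f; case: (L2f) => mf f_fin; split; first exact: qmeasurable_plane_shift.
rewrite (integral_plane_shift r (g := fun x => ((qnorm (f x)) ^+ 2)%:E))//.
apply/measurable_EFinP; apply: (eq_measurable_fun (fun x => qnorm2 (f x))).
  by move=> x _; rewrite /qnorm sqr_sqrtr ?qnorm2_ge0.
exact: qmeasurable_qnorm2.
Qed.

(** Each component of a quaternion is at most its norm. *)
Lemma qintegrable_dominated (R : realType) (F : R * R -> quat R)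
    (g : R * R -> R) : qmeasurable F ->
  (@mu2 R).-integrable setT (EFin \o g) -> (forall x, 0 <= g x) ->
  (forall x, qnorm2 (F x) <= g x ^+ 2) -> qintegrable F.
Proof.
move=> [F0 F1 F2 F3] ig g0 Fg.
have dom (h : R * R -> R) :
    measurable_fun [set: measurableTypeR R * measurableTypeR R] h ->
    (forall x, h x ^+ 2 <= qnorm2 (F x)) ->
    (@mu2 R).-integrable setT (EFin \o h).
  move=> mh hF; apply: le_integrable ig => //; first exact/measurable_EFinP.
  move=> x _ /=; rewrite lee_fin (ger0_norm (g0 x)).
  by rewrite -(ler_pXn2r (n := 2))// ?nnegrE// real_normK ?num_real// (le_trans (hF x)).
split; apply: dom => // x; rewrite qnorm2E;
  move: (sqr_ge0 (q0 (F x))) (sqr_ge0 (q1 (F x)))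
        (sqr_ge0 (q2 (F x))) (sqr_ge0 (q3 (F x))); lra.
Qed.

(** * The kernel of the linear canonical transform *)

(** The quaternions mu with mu^2 = -1. *)
Definition pure_unit (R : realFieldType) (mu : quat R) : Prop :=
  q0 mu = 0 /\ qnorm2 mu = 1.

Lemma pure_unit_qi (R : realFieldType) : pure_unit (@qi R).
Proof. by split => //; rewrite qnorm2E /=; ring. Qed.

Lemma pure_unit_qj (R : realFieldType) : pure_unit (@qj R).
Proof. by split => //; rewrite qnorm2E /=; ring. Qed.

Lemma qexpD (R : realType) (mu : quat R) (s t : R) : pure_unit mu ->
  qexp mu (s + t) = qexp mu s * qexp mu t.
Proof.
case: mu => a b c d [/= ->]; rewrite qnorm2E /= expr0n /= add0r => mu1.
rewrite /qexp cosD sinD; congr Quat => /=; try by ring.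
transitivity (cos s * cos t - sin s * sin t * (b ^+ 2 + c ^+ 2 + d ^+ 2)).
  by rewrite mu1; ring.
by ring.
Qed.

Lemma qnorm2_qexp (R : realType) (mu : quat R) (t : R) : pure_unit mu ->
  qnorm2 (qexp mu t) = 1.
Proof.
case: mu => a b c d [/= ->]; rewrite !qnorm2E /= expr0n /= add0r => mu1.
rewrite !mulr0 !mulr1 !addr0 !add0r !exprMn -addrA -addrA -!mulrDr addrA mu1.
by rewrite mulr1 cos2Dsin2.
Qed.

(** Elements of R + mu R commute with each other and with each other's inverses,
    and the kernel is the inverse of a square root in R + mu R times an
    exponential in R + mu R. *)
Lemma comm_qexp_kernel (R : realType) (mu : quat R) (A : 'M[R]_2) (s x w : R) :
  GRing.comm (qexp mu s) (lct_kernel mu A x w).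
Proof.
have planeP (a b c d : R) :
    GRing.comm (a%:A + b *: mu) (c%:A + d *: mu).
  by case: mu => ????; congr Quat => /=; ring.
apply: commrM; last exact: planeP.
apply: commrV; rewrite /qsqrt; case: ifP => _.
  by rewrite -[X in GRing.comm _ X]addr0 -(scale0r mu); exact: planeP.
by rewrite -[X in GRing.comm _ X]add0r -(scale0r (1 : quat R)); exact: planeP.
Qed.

Lemma det_mx2 (R : comNzRingType) (A : 'M[R]_2) :
  \det A = A 0 0 * A 1 1 - A 0 1 * A 1 0.
Proof.
rewrite (expand_det_row _ 0) !big_ord_recl big_ord0 /cofactor !det_mx11 !mxE.
rewrite addr0 /= expr0 mul1r expr1 mulN1r mulrN.
by congr (_ * A _ _ - A _ _ * A _ _); apply: val_inj.
Qed.

(** The exponents of the two sides agree: the terms linear in [x] match by the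
    choice of the new frequency [w - a * r], and what is left is
    a r^2 (1 - a d) / (2 b) + r w (a d - 1) / b, where a d - 1 = b c. *)
Lemma lct_kernel_shift (R : realType) (mu : quat R) (A : 'M[R]_2)
    (x r w : R) : pure_unit mu -> \det A = 1 -> A 0 1 != 0 ->
  lct_kernel mu A (x + r) w =
  qexp mu (r * w * A 1 0) * qexp mu (- (A 0 0 * r ^+ 2 / 2 * A 1 0)) *
  lct_kernel mu A x (w - A 0 0 * r).
Proof.
move=> mu_unit; rewrite det_mx2 => detA b_neq0.
(* The kernel is its constant prefactor times one exponential, so the extra
   factor is moved to the right and merged with that exponential. *)
rewrite -qexpD// comm_qexp_kernel /lct_kernel; cbv zeta.
rewrite -[RHS]mulrA -qexpD//.
congr (_ * qexp mu _).
have -> : A 1 0 = (A 0 0 * A 1 1 - 1) / A 0 1.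
  by apply: (mulfI b_neq0); rewrite mulrCA mulfV// mulr1 -detA; ring.
by field.
Qed.

Lemma qmeasurable_qexp (R : realType) (mu : quat R) (h : R * R -> R) :
  measurable_fun [set: measurableTypeR R * measurableTypeR R] h ->
  qmeasurable (fun x => qexp mu (h x)).
Proof.
move=> mh.
have mcos : measurable_fun [set: measurableTypeR R * measurableTypeR R]
    (fun x => cos (h x)).
  apply: measurableT_comp mh; apply: continuous_measurable_fun.
  exact: continuous_cos.
have msin : measurable_fun [set: measurableTypeR R * measurableTypeR R]
    (fun x => sin (h x)).
  apply: measurableT_comp mh; apply: continuous_measurable_fun.
  exact: continuous_sin.
by split; apply: measurable_funD; apply: measurable_funM.
Qed.

Lemma qmeasurable_kernel (R : realType) (mu : quat R) (A : 'M[R]_2) (w : R)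
    (g : R * R -> R) :
  measurable_fun [set: measurableTypeR R * measurableTypeR R] g ->
  qmeasurable (fun x => lct_kernel mu A (g x) w).
Proof.
move=> mg; apply: qmeasurableM; first exact: qmeasurable_cst.
apply: qmeasurable_qexp.
apply: measurable_funB => //; apply: measurable_funD => //.
apply: measurable_funB.
  by apply: measurable_funM => //; exact: measurable_funX.
by apply: measurable_funM => //; exact: measurable_funM.
Qed.

Lemma qnorm2_kernel (R : realType) (mu : quat R) (A : 'M[R]_2) (x w : R) :
  pure_unit mu ->
  qnorm2 (lct_kernel mu A x w) = qnorm2 (qsqrt mu (2 * pi * A 0 1))^-1.
Proof. by move=> mu1; rewrite qnorm2M qnorm2_qexp// mulr1. Qed.

(** * The shift formula *)

Definition qwlct_integrand (R : realType) (A1 A2 : 'M[R]_2)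
    (phi f : R * R -> quat R) (w u : R * R) (x : R * R) : quat R :=
  lct_kernel qi A1 x.1 w.1 * f x * qconj (phi (x - u)) *
  lct_kernel qj A2 x.2 w.2.

Lemma qmeasurable_qwlct_integrand (R : realType) (A1 A2 : 'M[R]_2)
    (phi f : R * R -> quat R) (w u : R * R) :
  qmeasurable phi -> qmeasurable f ->
  qmeasurable (qwlct_integrand A1 A2 phi f w u).
Proof.
move=> mphi mf; apply: qmeasurableM; last exact: qmeasurable_kernel.
apply: qmeasurableM.
  by apply: qmeasurableM mf; exact: qmeasurable_kernel.
exact/qmeasurable_conj/(qmeasurable_plane_shift u mphi).
Qed.

Lemma qintegrable_qwlct_integrand (R : realType) (A1 A2 : 'M[R]_2)
    (phi f : R * R -> quat R) (w u : R * R) : L2 phi -> L2 f ->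
  qintegrable (qwlct_integrand A1 A2 phi f w u).
Proof.
move=> phi_L2 f_L2.
set C := qnorm2 (qsqrt qi (2 * pi * A1 0 1))^-1 *
  qnorm2 (qsqrt qj (2 * pi * A2 0 1))^-1.
have C0 : 0 <= C by rewrite mulr_ge0 ?qnorm2_ge0.
(* The squared norm of the integrand is C |f|^2 |phi(x - u)|^2, where C is the
   constant squared modulus of the two kernels, and C <= (1 + C)^2. *)
pose g x := (1 + C) * (qnorm2 (f x) + qnorm2 (phi (@plane_shift R u x))).
apply: (@qintegrable_dominated _ _ g).
- by apply: qmeasurable_qwlct_integrand; [case: phi_L2 | case: f_L2].
- rewrite (_ : _ \o _ = (fun x => (1 + C)%:E * ((EFin \o (fun x => qnorm2 (f x)))
    \+ (EFin \o (fun x => qnorm2 (phi (@plane_shift R u x))))) x)%E)//.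
  apply: integrableZl => //; apply: integrableD => //.
    exact: L2_qnorm2_integrable.
  exact: (L2_qnorm2_integrable (L2_plane_shift u phi_L2)).
- by move=> x; apply: mulr_ge0; apply: addr_ge0; rewrite ?qnorm2_ge0.
move=> x; rewrite /qwlct_integrand 3!qnorm2M qnorm2_conj.
rewrite (qnorm2_kernel _ _ _ (pure_unit_qi R)).
rewrite (qnorm2_kernel _ _ _ (pure_unit_qj R)).
rewrite /g exprMn.
move: (qnorm2_ge0 (f x)) (qnorm2_ge0 (phi (@plane_shift R u x))).
rewrite -[x - u]/(@plane_shift R u x).
move: (qnorm2 (f x)) (qnorm2 (phi _)) => a b a0 b0.
rewrite (_ : _ * _ * _ * _ = C * (a * b)); last by rewrite /C; ring.
by apply: ler_pM => //; [exact: mulr_ge0 | nra | nra].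
Qed.

Theorem theorem4 (R : realType) (A1 A2 : 'M[R]_2)
    (detA1 : \det A1 = 1) (detA2 : \det A2 = 1)
    (b1_neq0 : A1 0 1 != 0) (b2_neq0 : A2 0 1 != 0)
    (phi : R * R -> quat R) (phi_L2 : L2 phi) (phi_neq0 : ~ L2_zero phi)
    (f : R * R -> quat R) (f_L2 : L2 f)
    (r w u : R * R) :
  let a1 := A1 0 0 in let c1 := A1 1 0 in
  let a2 := A2 0 0 in let c2 := A2 1 0 in
  let m := (w.1 - a1 * r.1, w.2 - a2 * r.2) in
  let n := (u.1 - r.1, u.2 - r.2) in
  qwlct A1 A2 phi (translate r f) w u =
    qexp qi (r.1 * w.1 * c1) * qexp qi (- (a1 * r.1 ^+ 2 / 2 * c1)) *
    qwlct A1 A2 phi f m n *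
    qexp qj (r.2 * w.2 * c2) * qexp qj (- (a2 * r.2 ^+ 2 / 2 * c2)).
Proof.
move=> a1 c1 a2 c2 m n.
set p := qexp qi _ * qexp qi _; rewrite -mulrA; set q := qexp qj _ * qexp qj _.
pose F := qwlct_integrand A1 A2 phi f m n.
have mF : qmeasurable F.
  by apply: qmeasurable_qwlct_integrand; [case: phi_L2 | case: f_L2].
transitivity (qint (fun x => p * F (@plane_shift R r x) * q)).
  congr qint; apply/funext => x.
  have -> : x - u = @plane_shift R r x - n.
    by congr pair => /=; ring.
  rewrite -[in LHS](subrK r.1 x.1) (lct_kernel_shift _ _ _ (pure_unit_qi R))//.
  rewrite -[in LHS](subrK r.2 x.2) (lct_kernel_shift _ _ _ (pure_unit_qj R))//.
  rewrite -/p -/q /F /qwlct_integrand.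
  (* The right kernel produces its factor on the left of itself; it is moved
     to the far right inside R + j R. *)
  have -> : q * lct_kernel qj A2 (x.2 - r.2) (w.2 - A2 0 0 * r.2) =
      lct_kernel qj A2 (x.2 - r.2) (w.2 - A2 0 0 * r.2) * q.
    by rewrite /q -qexpD ?comm_qexp_kernel//; exact: pure_unit_qj.
  by rewrite !mulrA.
rewrite (qint_plane_shift r (F := fun x => p * F x * q)).
  by apply: qint_mul; exact: qintegrable_qwlct_integrand.
apply: qmeasurableM; last exact: qmeasurable_cst.
by apply: qmeasurableM mF; exact: qmeasurable_cst.
Qed.
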